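(* In the setting described in the context, choose an initial point $x_0$ and confidence $0<\rho<1$, and let the accuracy $\epsilon>0$ and iteration counter $k$ be chosen in one of the following two ways: (i) $\epsilon<F(x_0)-F^*$ and $$k\geq\frac{2n\max\{\mathcal{R}_L^2(x_0),F(x_0)-F^*\}}{\epsilon}\left(1+\log\frac1\rho\right)+2-\frac{2n\max\{\mathcal{R}_L^2(x_0),F(x_0)-F^*\}}{F(x_0)-F^*};$$ (ii) $\epsilon<\min\{\mathcal{R}_L^2(x_0),F(x_0)-F^*\}$ and $$k\geq\frac{2n\mathcal{R}_L^2(x_0)}{\epsilon}\log\frac{F(x_0)-F^*}{\epsilon\rho}.$$ If $x_k$ is the random point generated by UCDC$(x_0)$ applied to $F$, then $\mathbf{P}(F(x_k)-F^*\leq\epsilon)\geq1-\rho$.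
   Context: Let $U\in\mathbf{R}^{N\times N}$ be a column permutation of the $N\times N$ identity matrix, partitioned as $U=[U_1,\dots,U_n]$ with $U_i\in\mathbf{R}^{N\times N_i}$, $\sum_iN_i=N$. For $x\in\mathbf{R}^N$ write $x^{(i)}=U_i^Tx$. Each $\mathbf{R}^{N_i}$ carries the norm $\|t\|_{(i)}=\langle B_it,t\rangle^{1/2}$ and dual norm $\|t\|_{(i)}^*=\langle B_i^{-1}t,t\rangle^{1/2}$ with $B_i$ positive definite. Consider minimizing $F(x)=f(x)+\Psi(x)$ over $\mathbf{R}^N$, where $f$ is convex and differentiable with $\|\nabla_if(x+U_it)-\nabla_if(x)\|_{(i)}^*\leq L_i\|t\|_{(i)}$ for all $x\in\mathbf{R}^N,t\in\mathbf{R}^{N_i}$, $i$ (constants $L_i>0$, $\nabla_if(x)=U_i^T\nabla f(x)$), and $\Psi(x)=\sum_i\Psi_i(x^{(i)})$ with each $\Psi_i$ proper closed convex. The problem has a minimizer; $F^*$ is the optimal value and $X^*$ the set of minimizers. Let $\|x\|_L=(\sum_iL_i\|x^{(i)}\|_{(i)}^2)^{1/2}$ and $\mathcal{R}_L(x)=\max_y\max_{x^*\in X^*}\{\|y-x^*\|_L: F(y)\leq F(x)\}$; $\mathcal{R}_L^2(x)$ denotes its square. Algorithm UCDC$(x_0)$: for $k=0,1,2,\dots$, choose $i\in\{1,\dots,n\}$ uniformly at random (independently), compute $T^{(i)}(x_k)=\arg\min_{t\in\mathbf{R}^{N_i}}\{\langle\nabla_if(x_k),t\rangle+\frac{L_i}{2}\|t\|_{(i)}^2+\Psi_i(x_k^{(i)}+t)\}$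 and set $x_{k+1}=x_k+U_iT^{(i)}(x_k)$. *)

(* Defs.v *)
From HB Require Import structures.
From mathcomp Require Import all_boot all_order all_algebra.
From mathcomp Require Import all_classical all_reals all_analysis.
Set Implicit Arguments. Unset Strict Implicit. Unset Printing Implicit Defensive.
Import Order.TTheory GRing.Theory Num.Theory.
Import numFieldNormedType.Exports.
Local Open Scope classical_set_scope.
Local Open Scope ring_scope.

Section UCDC.
Context {R : realType} {n : nat} (Ns : 'I_n -> nat).

Local Notation N := (\sum_(i < n) Ns i)%N.

Definition Ublk (U : 'M[R]_N) (i : 'I_n) : 'M[R]_(N, Ns i) := submxrow U i.

Definition blkc (U : 'M[R]_N) (i : 'I_n) (x : 'cV[R]_N) : 'cV[R]_(Ns i) :=
  (Ublk U i)^T *m x.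

Definition qform {m : nat} (B : 'M[R]_m) (t : 'cV[R]_m) : R := (t^T *m (B *m t)) 0 0.

Definition posdef {m : nat} (B : 'M[R]_m) : Prop :=
  B^T = B /\ forall t : 'cV[R]_m, t != 0 -> 0 < qform B t.

Definition bnorm {m : nat} (B : 'M[R]_m) (t : 'cV[R]_m) : R := Num.sqrt (qform B t).
Definition bdual {m : nat} (B : 'M[R]_m) (t : 'cV[R]_m) : R :=
  Num.sqrt (qform (invmx B) t).

Definition grad (f : 'cV[R]_N -> R) (x : 'cV[R]_N) : 'cV[R]_N :=
  \col_j ('d f x (delta_mx j 0 : 'cV[R]_N)).

Definition gradi (U : 'M[R]_N) (f : 'cV[R]_N -> R) (i : 'I_n) (x : 'cV[R]_N)
  : 'cV[R]_(Ns i) := (Ublk U i)^T *m grad f x.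

Definition convex_fun {m : nat} (f : 'cV[R]_m -> R) : Prop :=
  forall (x y : 'cV[R]_m) (l : R), 0 <= l <= 1 ->
    f (l *: x + (1 - l) *: y) <= l * f x + (1 - l) * f y.

Definition proper_fun {m : nat} (h : 'cV[R]_m -> \bar R) : Prop :=
  (forall t, h t != -oo%E) /\ (exists t, h t \is a fin_num).
Definition econvex_fun {m : nat} (h : 'cV[R]_m -> \bar R) : Prop :=
  forall (x y : 'cV[R]_m) (l : R), 0 <= l <= 1 ->
    (h (l *: x + (1 - l) *: y)%R <= l%:E * h x + (1 - l)%:E * h y)%E.
Definition proper_closed_convex {m : nat} (h : 'cV[R]_m -> \bar R) : Prop :=
  [/\ proper_fun h, lower_semicontinuous h & econvex_fun h].

Definition PsiSum (U : 'M[R]_N) (Psis : forall i : 'I_n, 'cV[R]_(Ns i) -> \bar R)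
  (x : 'cV[R]_N) : \bar R := (\sum_(i < n) Psis i (blkc U i x))%E.

Definition Fobj (U : 'M[R]_N) (f : 'cV[R]_N -> R)
  (Psis : forall i : 'I_n, 'cV[R]_(Ns i) -> \bar R) (x : 'cV[R]_N) : \bar R :=
  ((f x)%:E + PsiSum U Psis x)%E.

Definition optval (F : 'cV[R]_N -> \bar R) : \bar R := ereal_inf (range F).
Definition minimizers (F : 'cV[R]_N -> \bar R) : set 'cV[R]_N :=
  [set x | forall y, (F x <= F y)%E].

Definition Lnorm (U : 'M[R]_N) (B : forall i : 'I_n, 'M[R]_(Ns i))
  (L : 'I_n -> R) (x : 'cV[R]_N) : R :=
  Num.sqrt (\sum_(i < n) L i * bnorm (B i) (blkc U i x) ^+ 2).

Definition RLset (U : 'M[R]_N) (B : forall i : 'I_n, 'M[R]_(Ns i))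
  (L : 'I_n -> R) (F : 'cV[R]_N -> \bar R) (x0 : 'cV[R]_N) : set R :=
  [set r | exists y xs, [/\ (F y <= F x0)%E, minimizers F xs &
                           r = Lnorm U B L (y - xs)]].
Definition RL U B L F x0 : R := sup (RLset U B L F x0).

Definition step_obj (U : 'M[R]_N) (B : forall i : 'I_n, 'M[R]_(Ns i))
  (L : 'I_n -> R) (f : 'cV[R]_N -> R)
  (Psis : forall i : 'I_n, 'cV[R]_(Ns i) -> \bar R)
  (x : 'cV[R]_N) (i : 'I_n) (t : 'cV[R]_(Ns i)) : \bar R :=
  ((((gradi U f i x)^T *m t) 0 0 + L i / 2 * bnorm (B i) t ^+ 2)%:E
     + Psis i (blkc U i x + t)%R)%E.

Definition is_step_argmin U B L f Psis
  (T : 'cV[R]_N -> forall i : 'I_n, 'cV[R]_(Ns i)) : Prop :=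
  forall (x : 'cV[R]_N) (i : 'I_n) (t : 'cV[R]_(Ns i)), (@step_obj U B L f Psis x i (T x i)
     <= @step_obj U B L f Psis x i t)%E.

(* UCDC iterate after the block choices s = [i_0; ...; i_(k-1)] *)
Definition ucdc (U : 'M[R]_N) (T : 'cV[R]_N -> forall i : 'I_n, 'cV[R]_(Ns i))
  (x0 : 'cV[R]_N) (s : seq 'I_n) : 'cV[R]_N :=
  foldl (fun x i => x + Ublk U i *m T x i) x0 s.

End UCDC.

(* probability of an event about k i.i.d. uniform choices in {0,..,n-1} *)
Definition unif_prob {R : realType} (n k : nat) (P : k.-tuple 'I_n -> Prop) : R :=
  (#|[set s : k.-tuple 'I_n | `[< P s >]]|%:R / (n ^ k)%:R)%R.

(* Main.v *)
Require Import Defs.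
From HB Require Import structures.
From mathcomp Require Import all_boot all_order all_algebra all_fingroup.
From mathcomp Require Import all_classical all_reals all_analysis.
From mathcomp Require Import ring lra.
Import Order.TTheory GRing.Theory Num.Theory.
Import numFieldNormedType.Exports.
Local Open Scope classical_set_scope.
Local Open Scope ring_scope.

(** Let [xi x = F x - F*].  Optimality of the block step together with the
    descent inequality [f (x + U_i t) <= f x + <grad_i f x, t> + L_i/2 |t|^2]
    shows that every step decreases [F], and, after comparing with the steps
    [t_i = a (x* - x)^(i)], that a uniformly random step satisfies
    [E xi' <= xi - (a xi - a^2 R_L^2 / 2) / n] for every [a] in [0, 1].
    The choice [a = xi / max (R_L^2, xi_0)] gives [E xi' <= xi - xi^2 / c], and
    [a = eps / R_L^2] gives [E xi' <= (1 - 1 / c) xi] as long as [xi >= eps].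
    Truncating [xi] to [0] below [eps] makes both recursions hold everywhere;
    the mean of the truncated process then falls below [eps rho] within the
    prescribed number of steps, and Markov's inequality concludes. *)

(** * Expectations along a chain driven by uniform random choices *)

Section UniformChain.
Context {R : realType} {n : nat} {X : Type}.
Variable step : X -> 'I_n -> X.

(** The transition operator of the chain: [iter k (avg g) x], read as [iter k avg g x], is the mean
    of [g] after [k] steps from [x]. *)
Definition avg (g : X -> R) (x : X) : R := (\sum_(i < n) g (step x i)) / n%:R.

Lemma sum_tuple_cons k (h : k.+1.-tuple 'I_n -> R) :
  \sum_s h s = \sum_(i < n) \sum_(t : k.-tuple 'I_n) h [tuple of i :: t].
Proof.
rewrite pair_bigA /=.
rewrite (reindex (fun p : 'I_n * k.-tuple 'I_n => [tuple of p.1 :: p.2])) //=.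
exists (fun s => (thead s, [tuple of behead s])) => [[i t] _|s _] /=.
  by congr (_, _); apply: val_inj.
by rewrite -tuple_eta.
Qed.

(** Conditioning on the first choice, the head of the tuple, peels off the outermost [avg].
    Probabilities thus become iterates of an operator and tuples disappear from the later
    arguments. *)
Lemma sum_tuple_foldl k (g : X -> R) x :
  (\sum_(s : k.-tuple 'I_n) g (foldl step x s)) / (n ^ k)%:R = iter k avg g x.
Proof.
elim: k x => [|k IH] x.
  rewrite expn0 divr1 (big_pred1 [tuple]) // => s.
  exact/esym/eqP/tuple0.
rewrite sum_tuple_cons iterS /avg expnS natrM invfM mulrA mulrAC; congr (_ / _).
by rewrite mulr_suml; apply: eq_bigr => i _; rewrite /= IH.
Qed.

Lemma unif_prob_foldl k (P : X -> Prop) x :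
  unif_prob (fun s : k.-tuple 'I_n => P (foldl step x s)) =
  iter k avg (fun y => `[< P y >]%:R) x.
Proof.
rewrite -sum_tuple_foldl /unif_prob; congr (_ / _).
rewrite -sum1_card natr_sum big_mkcond /=.
apply: eq_bigr => s _; rewrite unfold_in /in_set /mkset asboolb.
by case: asboolP.
Qed.

Hypothesis n_gt0 : (0 < n)%N.

Lemma avg_affine (a b : R) g x : avg (fun y => a * g y + b) x = a * avg g x + b.
Proof.
have n0 : n%:R != 0 :> R by rewrite pnatr_eq0 -lt0n.
rewrite /avg big_split /= -mulr_sumr sumr_const card_ord -mulr_natr.
by field.
Qed.

Lemma iter_avg_affine k (a b : R) g x :
  iter k avg (fun y => a * g y + b) x = a * iter k avg g x + b.
Proof.
elim: k x => [//|k IH] x; rewrite !iterS -avg_affine.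
by rewrite /avg; under eq_bigr do rewrite IH.
Qed.

Variable S : X -> Prop.
Hypothesis S_step : forall x i, S x -> S (step x i).

(** The chain never leaves the invariant set [S], so a comparison on [S] alone survives
    averaging. *)
Lemma iter_avg_le k (g h : X -> R) x :
  (forall y, S y -> g y <= h y) -> S x -> iter k avg g x <= iter k avg h x.
Proof.
move=> gh; elim: k x => [|k IH] x Sx; first exact: gh.
rewrite !iterS /avg ler_wpM2r ?invr_ge0 ?ler0n//.
by apply: ler_sum => i _; apply/IH/S_step.
Qed.

Lemma iter_avg_ge0 k (g : X -> R) x :
  (forall y, S y -> 0 <= g y) -> S x -> 0 <= iter k avg g x.
Proof.
move=> g0 Sx.
have <- : iter k avg (fun y => 0 * g y + 0) x = 0.
  by rewrite iter_avg_affine mul0r addr0.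
by apply: iter_avg_le => // y Sy; rewrite mul0r addr0 g0.
Qed.

(** Here the last step is split off instead of the first: the one-step bound is applied at the
    [k]-th point and then averaged, which an affine bound permits. *)
Lemma iter_avgS_le k (a b : R) (g : X -> R) x :
  (forall y, S y -> avg g y <= a * g y + b) -> S x ->
  iter k.+1 avg g x <= a * iter k avg g x + b.
Proof.
by move=> ag Sx; rewrite iterSr -iter_avg_affine; apply: iter_avg_le.
Qed.

(** Markov's inequality: on [S] the indicator of [P] is pointwise at least [1 - g / eps], and
    averaging is monotone and affine. *)
Lemma markov_iter_avg k (g : X -> R) (P : X -> Prop) (eps : R) x :
  0 < eps -> (forall y, S y -> 0 <= g y) ->
  (forall y, S y -> ~ P y -> eps <= g y) -> S x ->
  1 - iter k avg g x / eps <= iter k avg (fun y => `[< P y >]%:R) x.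
Proof.
move=> e0 g0 gP Sx.
have -> : 1 - iter k avg g x / eps = - eps^-1 * iter k avg g x + 1.
  by rewrite mulNr mulrC addrC.
rewrite -iter_avg_affine; apply: iter_avg_le => // y Sy.
rewrite mulNr mulrC addrC; case: asboolP => Py /=.
  by rewrite lerBlDr lerDl divr_ge0 ?g0 ?ltW.
by rewrite subr_le0 ler_pdivlMr // mul1r gP.
Qed.

(** * Decay of the truncated process and the resulting confidence bounds *)

Variables (xi : X -> R) (eps : R).
Hypothesis eps_gt0 : 0 < eps.
Hypothesis xi_ge0 : forall x, S x -> 0 <= xi x.
Hypothesis xi_step : forall x i, S x -> xi (step x i) <= xi x.

Definition trunc (x : X) : R := if eps <= xi x then xi x else 0.

Lemma trunc_ge0 x : S x -> 0 <= trunc x.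
Proof. by move=> Sx; rewrite /trunc; case: ifP => // _; apply: xi_ge0. Qed.

Lemma trunc_le x : S x -> trunc x <= xi x.
Proof. by move=> Sx; rewrite /trunc; case: ifP => // _; apply: xi_ge0. Qed.

(* Below the threshold the truncated process is stuck at 0, because [xi]
   decreases along every step. *)
Lemma avg_trunc_le (a b : R) :
  0 <= b -> (forall x, S x -> eps <= xi x -> avg xi x <= a * xi x + b) ->
  forall x, S x -> avg trunc x <= a * trunc x + b.
Proof.
move=> b0 H x Sx; rewrite {2}/trunc; case: (leP eps (xi x)) => [ex|xe].
  apply: le_trans (H x Sx ex).
  rewrite /avg ler_wpM2r ?invr_ge0 ?ler0n//.
  by apply: ler_sum => i _; apply/trunc_le/S_step.
rewrite mulr0 add0r /avg big1 ?mul0r// => i _.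
by rewrite /trunc leNgt (le_lt_trans (xi_step x i Sx)).
Qed.

Lemma iter_avg_trunc_geometric (q : R) (j k : nat) x : 0 <= q ->
  (forall y, S y -> eps <= xi y -> avg xi y <= q * xi y) -> S x ->
  iter (j + k) avg trunc x <= q ^+ j * iter k avg trunc x.
Proof.
move=> q0 H Sx; elim: j => [|j IH]; first by rewrite expr0 mul1r.
have D y : S y -> avg trunc y <= q * trunc y + 0.
  by apply: avg_trunc_le => // z Sz ez; rewrite addr0 H.
rewrite addSn; apply: le_trans (iter_avgS_le _ _ _ _ _ D Sx) _.
by rewrite addr0 exprS -mulrA ler_wpM2l.
Qed.

(** With [t] the mean after [k] steps, this is [1 / t >= 1 / xi x + k / c] cleared of denominators,
    so that [t = 0] needs no exception. *)
Lemma iter_avg_trunc_sublinear (c : R) k x : 0 < c ->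
  (forall y, S y -> avg xi y <= xi y - xi y ^+ 2 / c) -> S x ->
  iter k avg trunc x * (k%:R * xi x + c) <= c * xi x.
Proof.
move=> c0 H Sx; have xi0 := xi_ge0 x Sx.
elim: k => [|k IH]; first by rewrite mul0r add0r mulrC ler_wpM2l ?(ltW c0) //= trunc_le.
set t := iter k avg trunc x in IH.
have t0 : 0 <= t by apply: iter_avg_ge0 => // y; apply: trunc_ge0.
set t' := iter k.+1 avg trunc x.
have t'0 : 0 <= t' by apply: iter_avg_ge0 => // y; apply: trunc_ge0.
(* Jensen's inequality by the tangent of the square at the mean [t]. *)
have D y : S y -> avg trunc y <= (1 - 2 * t / c) * trunc y + t ^+ 2 / c.
  apply: avg_trunc_le => [|z Sz _]; first by rewrite divr_ge0 ?sqr_ge0 ?ltW.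
  apply: le_trans (H z Sz) _; rewrite -subr_ge0.
  have -> : (1 - 2 * t / c) * xi z + t ^+ 2 / c - (xi z - xi z ^+ 2 / c) =
    (xi z - t) ^+ 2 / c by field; rewrite gt_eqF.
  by rewrite divr_ge0 ?sqr_ge0 ?ltW.
have {}D : t' <= t - t ^+ 2 / c.
  apply: le_trans (iter_avgS_le k _ _ _ _ D Sx) _.
  by rewrite -/t le_eqVlt; apply/orP; left; apply/eqP; field; rewrite gt_eqF.
have {}D : t' * c <= t * c - t ^+ 2.
  have : t' * c <= (t - t ^+ 2 / c) * c by rewrite ler_wpM2r// ltW.
  by rewrite mulrBl mulfVK ?gt_eqF.
(* For [t' > 0] the recursion amounts to [1 / t' >= 1 / t + 1 / c], which is [le1] below; the
   induction hypothesis is then used after multiplying the goal by [t]. *)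
have [->|tN0] := eqVneq t' 0; first by rewrite mul0r mulr_ge0// ltW.
have tp : 0 < t' by rewrite lt_def tN0.
have tt : 0 < t by nra.
have le1 : t' * (c + t) <= c * t by nra.
have : t * (t' * (k.+1%:R * xi x + c)) <= t * (c * xi x).
  have -> : t * (t' * (k.+1%:R * xi x + c)) =
    t' * (t * (k%:R * xi x + c)) + t' * t * xi x by rewrite -natr1; ring.
  have : t' * (t * (k%:R * xi x + c)) <= t' * (c * xi x) by rewrite ler_wpM2l.
  have : t' * (c + t) * xi x <= c * t * xi x by rewrite ler_wpM2r.
  by lra.
by rewrite ler_pM2l.
Qed.

(** From [1 - a <= expR (- a)]; the bound [a <= 1] keeps the base nonnegative, so that powers
    preserve the inequality. *)
Lemma exprB1_le_expR (a : R) k : a <= 1 -> (1 - a) ^+ k <= expR (- (a * k%:R)).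
Proof.
move=> a1; rewrite -mulNr mulrC expRM_natl.
by rewrite lerXn2r ?nnegrE ?expR_ge0 ?subr_ge0// expR_ge1Dx.
Qed.

(** The truncated mean is at most [(1 - c^-1) ^+ k * xi x], hence at most [expR (- k / c) * xi x],
    and the condition on [k] makes this at most [eps * rho]. *)
Lemma chain_prob_geometric (c rho : R) k x : 1 <= c -> 0 < rho ->
  (forall y, S y -> eps <= xi y -> avg xi y <= (1 - c^-1) * xi y) -> S x ->
  c * ln (xi x / (eps * rho)) <= k%:R ->
  1 - rho <= iter k avg (fun y => `[< xi y <= eps >]%:R) x.
Proof.
move=> c1 r0 H Sx hk; have c0 : 0 < c by apply: lt_le_trans c1.
apply: le_trans (markov_iter_avg _ trunc _ _ _ eps_gt0 trunc_ge0 _ Sx); last first.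
  by move=> y Sy /negP; rewrite -ltNge /trunc => /ltW ey; rewrite ey.
rewrite lerD2l lerNl opprK ler_pdivrMr//.
have q0 : 0 <= 1 - c^-1 by rewrite subr_ge0 invf_le1.
have := iter_avg_trunc_geometric _ k 0 x q0 H Sx; rewrite addn0 => /le_trans; apply.
have le1 : (1 - c^-1) ^+ k * trunc x <= (1 - c^-1) ^+ k * xi x.
  by rewrite ler_wpM2l ?exprn_ge0 ?trunc_le.
apply: le_trans le1 _.
(* The logarithm is only meaningful for [xi x > 0]; at 0 the bound is immediate. *)
have [x0|xN0] := eqVneq (xi x) 0; first by rewrite x0 mulr0 mulr_ge0 ?ltW.
have xp : 0 < xi x by rewrite lt_def xN0 xi_ge0.
rewrite -ler_pdivlMr//; apply: le_trans (exprB1_le_expR _ _ _) _.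
  by rewrite invf_le1.
rewrite -[leRHS]lnK ?posrE ?divr_gt0 ?mulr_gt0// ler_expR lerNl.
rewrite -lnV ?posrE ?divr_gt0 ?mulr_gt0//.
by rewrite invf_div (mulrC rho) [leRHS]mulrC ler_pdivlMr// [leLHS]mulrC.
Qed.

(** Two phases: the sublinear rate brings the truncated mean down to [eps] in [k1] steps, then the
    geometric rate [1 - eps / c] gains the factor [rho] in the remaining [k - k1] steps. *)
Lemma chain_prob_sublinear (c rho : R) k x : eps <= c -> 0 < rho < 1 ->
  (forall y, S y -> avg xi y <= xi y - xi y ^+ 2 / c) -> S x -> eps <= xi x ->
  c / eps * (1 + ln rho^-1) + 2 - c / xi x <= k%:R ->
  1 - rho <= iter k avg (fun y => `[< xi y <= eps >]%:R) x.
Proof.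
move=> ec /andP[r0 r1] H Sx ex hk.
have xp : 0 < xi x := lt_le_trans eps_gt0 ex.
have c0 : 0 < c by apply: lt_le_trans ec.
apply: le_trans (markov_iter_avg _ trunc _ _ _ eps_gt0 trunc_ge0 _ Sx); last first.
  by move=> y Sy /negP; rewrite -ltNge /trunc => /ltW ey; rewrite ey.
rewrite lerD2l lerNl opprK ler_pdivrMr//.
have lr : 0 < ln rho^-1 by rewrite ln_gt0// invf_gt1.
have A0 : 0 <= c / eps - c / xi x.
  by rewrite subr_ge0 ler_pM2l// lef_pV2 ?posrE.
(* [k1] is the integer part of [c / eps - c / xi x] plus one. This rounding costs at most 1, so the
   summand 2 in the bound on [k] covers it. *)
have /andP[k1l k1u] := truncn_itv A0.
set k1 := (Num.trunc _).+1 in k1u.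
have B0 : 0 < c / eps * ln rho^-1 by rewrite mulr_gt0 ?divr_gt0.
have k1S : k1%:R <= c / eps - c / xi x + 1 by rewrite /k1 -natr1 lerD2r.
have kk1 : (k1 <= k)%N by rewrite -(ler_nat R); lra.
have hd : c / eps * ln rho^-1 <= (k - k1)%:R by rewrite natrB//; lra.
have q0 : 0 <= 1 - eps / c by rewrite subr_ge0 ler_pdivrMr// mul1r.
(* Above the threshold [xi y ^+ 2 >= eps * xi y], so the quadratic decrease is also a geometric
   one. *)
have D y : S y -> eps <= xi y -> avg xi y <= (1 - eps / c) * xi y.
  move=> Sy ey; apply: le_trans (H y Sy) _.
  rewrite mulrBl mul1r lerD2l lerN2 mulrAC ler_pM2r ?invr_gt0//.
  by rewrite expr2 ler_wpM2r ?xi_ge0.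
have := iter_avg_trunc_geometric _ (k - k1) k1 x q0 D Sx.
rewrite subnK// => /le_trans; apply.
(* The value [c * xi x / (k1 * xi x + c)] is at most [eps] exactly when
   [k1 >= c / eps - c / xi x]. *)
have t1 : iter k1 avg trunc x <= eps.
  have := iter_avg_trunc_sublinear c k1 x c0 H Sx.
  have pp : 0 < k1%:R * xi x + c by rewrite ltr_wpDl// mulr_ge0 ?ler0n ?ltW.
  rewrite -ler_pdivlMr// => /le_trans; apply.
  rewrite ler_pdivrMr//.
  have : (c / eps - c / xi x) * (xi x * eps) <= k1%:R * (xi x * eps).
    by rewrite ler_wpM2r ?mulr_ge0 ?ltW.
  have -> : (c / eps - c / xi x) * (xi x * eps) = c * xi x - c * eps.
    by field; rewrite !gt_eqF.
  by lra.
apply: ler_pM; rewrite ?exprn_ge0//.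
  by apply: iter_avg_ge0 => // y; apply: trunc_ge0.
apply: le_trans (exprB1_le_expR _ _ _) _; first by rewrite ler_pdivrMr// mul1r.
rewrite -[leRHS]lnK ?posrE// ler_expR lerNl -lnV ?posrE//.
by rewrite mulrAC ler_pdivlMr// mulrC -ler_pdivrMl// mulrA (mulrC _ c).
Qed.

End UniformChain.

(** * Positive definite forms and the duality of their norms *)

Lemma dotmxBl {R : realType} {m : nat} (u w t : 'cV[R]_m) :
  ((u - w)^T *m t) 0 0 = (u^T *m t) 0 0 - (w^T *m t) 0 0.
Proof. by rewrite linearB /= mulmxBl !mxE. Qed.

Section PosDef.
Context {R : realType} {m : nat}.
Variable B : 'M[R]_m.
Hypothesis Bpos : posdef B.
Implicit Types t u w : 'cV[R]_m.

Lemma qform0 (A : 'M[R]_m) : qform A 0 = 0.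
Proof. by rewrite /qform mulmx0 mulmx0 mxE. Qed.

Lemma posdef_ge0 t : 0 <= qform B t.
Proof.
have [->|t0] := eqVneq t 0; first by rewrite qform0.
by case: Bpos => _ /(_ _ t0)/ltW.
Qed.

Lemma qformZ (A : 'M[R]_m) a t : qform A (a *: t) = a ^+ 2 * qform A t.
Proof.
by rewrite /qform linearZ /= -scalemxAl -!scalemxAr scalerA mxE -expr2.
Qed.

Lemma bnorm_sqr t : bnorm B t ^+ 2 = qform B t.
Proof. by rewrite /bnorm sqr_sqrtr ?posdef_ge0. Qed.

Lemma bnormZ (a : R) t : 0 <= a -> bnorm B (a *: t) = a * bnorm B t.
Proof.
by move=> a0; rewrite /bnorm qformZ sqrtrM ?sqr_ge0// sqrtr_sqr ger0_norm.
Qed.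

Lemma posdef_unitmx : B \in unitmx.
Proof.
rewrite -row_free_unit; apply: inj_row_free => v vB.
apply/eqP; apply: contraT => v0.
have : v^T != 0 by rewrite trmx_eq0.
case: Bpos => _ /[apply].
by rewrite /qform trmxK mulmxA vB mul0mx mxE ltxx.
Qed.

Lemma qform_comb (a b : R) w t :
  qform B (a *: w + b *: t) =
  a ^+ 2 * qform B w + 2 * a * b * (w^T *m (B *m t)) 0 0 + b ^+ 2 * qform B t.
Proof.
have sym : (t^T *m (B *m w)) 0 0 = (w^T *m (B *m t)) 0 0.
  have -> : (t^T *m (B *m w)) 0 0 = (t^T *m (B *m w))^T 0 0 by rewrite [RHS]mxE.
  by rewrite !trmx_mul trmxK mulmxA; case: Bpos => ->.
rewrite /qform linearD /= !linearZ /= mulmxDr mulmxDl !mulmxDr.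
rewrite -!scalemxAl -!scalemxAr.
move: sym; move: (w^T *m (B *m w)) (w^T *m (B *m t)) (t^T *m (B *m w)).
by move: (t^T *m (B *m t)) => A1 A2 A3 A4 sym; rewrite !mxE sym; ring.
Qed.

Lemma posdef_cauchy_schwarz w t :
  (w^T *m (B *m t)) 0 0 <= bnorm B w * bnorm B t.
Proof.
set b := (w^T *m _) 0 0.
have [t0|t0] := eqVneq t 0.
  by rewrite /b t0 !mulmx0 mxE mulr_ge0 // sqrtr_ge0.
have qt : 0 < qform B t by case: Bpos => _; apply.
(* This vector is [qform B t] times the component of [w] that is [B]-orthogonal to [t]; its form
   equals [qform B t * (qform B w * qform B t - b ^+ 2)]. *)
have := posdef_ge0 (qform B t *: w + (- b) *: t); rewrite qform_comb -/b => H.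
have {H} : 0 <= qform B t * (qform B w * qform B t - b ^+ 2).
  by apply: le_trans H _; rewrite le_eqVlt; apply/orP; left; apply/eqP; ring.
rewrite pmulr_rge0// subr_ge0 => H.
apply: le_trans (ler_norm b) _; rewrite -sqrtr_sqr -sqrtrM ?posdef_ge0//.
exact: ler_wsqrtr.
Qed.

(** Writing [u = B *m w] turns the pairing into the [B]-inner product of [w] and [t], and the dual
    norm of [u] into the norm of [w]. *)
Lemma dual_cauchy_schwarz u t : (u^T *m t) 0 0 <= bdual B u * bnorm B t.
Proof.
have BU := posdef_unitmx; set w := invmx B *m u.
have uE : u = B *m w by rewrite /w mulKVmx.
have -> : u^T *m t = w^T *m (B *m t).
  by rewrite {1}uE trmx_mul mulmxA; case: Bpos => ->.
suff -> : bdual B u = bnorm B w by exact: posdef_cauchy_schwarz.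
rewrite /bdual /bnorm /qform -/w; congr (Num.sqrt (_ 0 0)).
by rewrite {1}uE trmx_mul -mulmxA; case: Bpos => ->.
Qed.

End PosDef.

(** * Block coordinates, gradients and the block descent inequality *)

Section Blocks.
Context {R : realType} {n : nat} {Ns : 'I_n -> nat}.
Local Notation N := (\sum_(i < n) Ns i)%N.
Variable U : 'M[R]_N.
Hypothesis Uperm : is_perm_mx U.
Implicit Types x y : 'cV[R]_N.

Lemma perm_mx_trK : U^T *m U = 1%:M.
Proof.
case/is_perm_mxP: Uperm => s ->.
by rewrite tr_perm_mx -perm_mxM mulVg perm_mx1.
Qed.

Lemma tr_perm_mxK : U *m U^T = 1%:M.
Proof. exact/mulmx1C/perm_mx_trK. Qed.

Lemma Ublk_trmul i j : (Ublk U i)^T *m Ublk U j = submxblock 1%:M i j.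
Proof.
by rewrite /Ublk tr_submxrow mul_submxrow submxcol_mul perm_mx_trK submxblockEv.
Qed.

Lemma blkcD i x y : blkc U i (x + y) = blkc U i x + blkc U i y.
Proof. exact: mulmxDr. Qed.

Lemma blkcN i x : blkc U i (- x) = - blkc U i x.
Proof. exact: mulmxN. Qed.

Lemma blkc_Ublk i (t : 'cV[R]_(Ns i)) : blkc U i (Ublk U i *m t) = t.
Proof.
by rewrite /blkc mulmxA Ublk_trmul -mxdiagZ submxblock_diag mul1mx.
Qed.

Lemma blkc_Ublk_neq i j (t : 'cV[R]_(Ns i)) :
  j != i -> blkc U j (Ublk U i *m t) = 0.
Proof.
move=> ji; rewrite /blkc mulmxA Ublk_trmul.
have : is_diag_mx (1%:M : 'M[R]_N) by exact: scalar_mx_is_diag.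
rewrite -(submxblockK (1%:M : 'M[R]_N)) => /is_diag_mxblockP[/(_ _ _ ji) + _].
by rewrite submxblockK => ->; rewrite mul0mx.
Qed.

(** The block projections [Ublk U i *m (Ublk U i)^T] sum to [U *m U^T], the identity. *)
Lemma sum_blkc_dot x y :
  \sum_(i < n) ((blkc U i x)^T *m blkc U i y) 0 0 = (x^T *m y) 0 0.
Proof.
have sumU : \sum_(i < n) Ublk U i *m (Ublk U i)^T = 1%:M.
  by rewrite -tr_perm_mxK -{3 4}(submxrowK U) tr_mxrow mul_mxrow_mxcol.
rewrite -[y in RHS]mul1mx -sumU mulmx_suml mulmx_sumr summxE.
by apply: eq_bigr => i _; rewrite /blkc trmx_mul trmxK !mulmxA.
Qed.

Section Smooth.
Variable f : 'cV[R]_N -> R.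
Hypothesis fdiff : forall x, differentiable f x.

Lemma diffE_grad x v : 'd f x v = ((grad f x)^T *m v) 0 0.
Proof.
rewrite {1}(matrix_sum_delta v) mxE linear_sum; apply: eq_bigr => i _.
by rewrite linear_sum big_ord1 linearZ /= !mxE mulrC.
Qed.

Lemma is_derive_line x v (s : R) :
  is_derive s 1 (fun r => f (x + r *: v)) ('d f (x + s *: v) v).
Proof.
have qE : (fun h : R => h^-1 *: (((fun r => f (x + r *: v)) \o shift s) (h *: 1)
            - f (x + s *: v))) =
  (fun h : R => h^-1 *: ((f \o shift (x + s *: v)) (h *: v) - f (x + s *: v))).
  apply/funext => h /=; congr (_ *: (f _ - _)).
  by rewrite scaler1 scalerDl addrCA.
split; first by rewrite /derivable qE; exact: diff_derivable.
by rewrite /derive qE -deriveE.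
Qed.

(** By convexity the difference quotients along [y - x] with step [0 < h <= 1] are at most
    [f y - f x]; the right-hand limit keeps the bound. *)
Lemma convex_gradient_ineq x y : convex_fun f ->
  f x + ((grad f x)^T *m (y - x)) 0 0 <= f y.
Proof.
move=> cf; rewrite addrC -lerBrDr -diffE_grad -deriveE//.
have D : derivable f x (y - x) by exact: diff_derivable.
rewrite /derive cvg_at_rightE//; apply: limr_le.
  by apply/cvg_ex; exists ('D_(y - x) f x); apply: cvg_dnbhs_at_right.
near=> h.
have h0 : 0 < h by [].
have h1 : h <= 1 by near: h; exact: nbhs_right_le.
rewrite /= -[_ *: _]/(h^-1 * _) mulrC ler_pdivrMr//.
have -> : h *: (y - x) + x = h *: y + (1 - h) *: x.
  by rewrite scalerBr scalerBl scale1r -addrA (addrC (- _)).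
have /(cf y x) : 0 <= h <= 1 by rewrite ltW.
by lra.
Unshelve. all: by end_near. Qed.

Variables (B : forall i : 'I_n, 'M[R]_(Ns i)) (L : 'I_n -> R).
Hypothesis Bpos : forall i, posdef (B i).
Hypothesis fLip : forall x i (t : 'cV[R]_(Ns i)),
  bdual (B i) (gradi U f i (x + Ublk U i *m t) - gradi U f i x)
    <= L i * bnorm (B i) t.

(** The mean value theorem on [[0, 1]] replaces integration of the gradient. It is applied to
    [phi s = f (x + s v) - a s - b s^2], whose derivative is nonpositive at the intermediate point
    by the dual Cauchy-Schwarz inequality and the Lipschitz bound. *)
Lemma block_descent x i (t : 'cV[R]_(Ns i)) :
  f (x + Ublk U i *m t) <=
  f x + ((gradi U f i x)^T *m t) 0 0 + L i / 2 * bnorm (B i) t ^+ 2.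
Proof.
have [G GE] : {G | forall y, ((gradi U f i y)^T *m t) 0 0 = G y}.
  by exists (fun y => ((gradi U f i y)^T *m t) 0 0).
have CS y : G y - G x <=
    bdual (B i) (gradi U f i y - gradi U f i x) * bnorm (B i) t.
  rewrite -!GE -dotmxBl; exact: dual_cauchy_schwarz.
rewrite GE; move: (G x) CS => a CS.
set v := Ublk U i *m t; set b := L i / 2 * _.
pose phi := (fun r : R => f (x + r *: v)) - ((a \*: id) + (b \*: (@id R ^+ 2))).
pose dphi (s : R) := 'd f (x + s *: v) v - (a *: 1 + b *: ((2 * s ^+ 1) *: 1)).
have dE y : 'd f y v = G y.
  by rewrite -GE diffE_grad /v mulmxA /gradi trmx_mul trmxK.
have Dphi (s : R) : is_derive s 1 phi (dphi s).
  by apply: is_deriveB; exact: is_derive_line.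
have [|c] := @MVT _ phi dphi 0 1 ltr01 (fun s _ => Dphi s).
  by apply: derivable_within_continuous => s _; case: (Dphi s).
rewrite in_itv /= => /andP[c0 c1].
rewrite subr0 mulr1.
have -> : phi 1 - phi 0 = f (x + v) - f x - a - b.
  rewrite /phi /= !fctE /= scale1r scale0r addr0 /GRing.scale /=; ring.
move=> phiE.
suff : dphi c <= 0 by rewrite -phiE; lra.
rewrite /dphi dE /GRing.scale /= !mulr1 expr1.
have := CS (x + c *: v); move: (G _) => g.
have -> : c *: v = Ublk U i *m (c *: t) by rewrite /v scalemxAr.
have := fLip x i (c *: t); rewrite (bnormZ _ _ _ (ltW c0)).
rewrite /b; move: (bdual _ _) (bnorm _ _) (sqrtr_ge0 _ : 0 <= bnorm (B i) t).
move=> u r r0 uL gu.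
have : u * r <= L i * (c * r) * r by rewrite ler_wpM2r.
by lra.
Qed.

End Smooth.
End Blocks.

(** * One block step on the composite objective *)

Section Objective.
Context {R : realType} {n : nat} {Ns : 'I_n -> nat}.
Local Notation N := (\sum_(i < n) Ns i)%N.
Variables (U : 'M[R]_N) (B : forall i : 'I_n, 'M[R]_(Ns i)).
Variables (f : 'cV[R]_N -> R) (L : 'I_n -> R).
Variable Psis : forall i : 'I_n, 'cV[R]_(Ns i) -> \bar R.
Variable T : 'cV[R]_N -> forall i : 'I_n, 'cV[R]_(Ns i).
Hypothesis Uperm : is_perm_mx U.
Hypothesis Bpos : forall i, posdef (B i).
Hypothesis fdiff : forall x, differentiable f x.
Hypothesis fconv : convex_fun f.
Hypothesis fLip : forall x i (t : 'cV[R]_(Ns i)),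
  bdual (B i) (gradi U f i (x + Ublk U i *m t) - gradi U f i x)
    <= L i * bnorm (B i) t.
Hypothesis Lpos : forall i, 0 < L i.
Hypothesis Psis_pcc : forall i, proper_closed_convex (Psis i).
Hypothesis Targmin : is_step_argmin U B L f Psis T.
Implicit Types x y : 'cV[R]_N.

Local Notation F := (Fobj U f Psis).
Definition ucdc_step x i := x + Ublk U i *m T x i.
Local Notation step := ucdc_step.
Let psi i x : R := fine (Psis i (blkc U i x)).

Lemma Psis_fin i (t : 'cV[R]_(Ns i)) :
  (Psis i t < +oo)%E -> Psis i t \is a fin_num.
Proof.
by move=> Poo; case: (Psis_pcc i) => -[/(_ t) PN _] _ _; rewrite fin_numE PN lt_eqF.
Qed.

Lemma Fobj_finE x :
  (F x \is a fin_num) = [forall i, Psis i (blkc U i x) \is a fin_num].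
Proof.
rewrite /Fobj fin_numD /= /PsiSum; apply/sum_fin_numP/forallP => H i.
  by apply: H => //; rewrite mem_index_enum.
by move=> _ _; apply: H.
Qed.

Lemma Fobj_fin x : (F x < +oo)%E -> F x \is a fin_num.
Proof.
move=> Foo; rewrite fin_numE (lt_eqF Foo) andbT /Fobj adde_eq_ninfty /=.
rewrite /PsiSum esum_eqNy; apply/existsP => -[i /andP[_]].
by case: (Psis_pcc i) => -[/(_ (blkc U i x))/negbTE -> _].
Qed.

Lemma Psis_blkc_fin x i : F x \is a fin_num -> Psis i (blkc U i x) \is a fin_num.
Proof. by rewrite Fobj_finE => /forallP. Qed.

Lemma fine_Fobj x : F x \is a fin_num -> fine (F x) = f x + \sum_(i < n) psi i x.
Proof.
move=> Fx; have Px i : true -> Psis i (blkc U i x) \is a fin_num.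
  by move=> _; apply: Psis_blkc_fin.
by rewrite /Fobj /PsiSum -(EFin_sum_fine _ Px).
Qed.

Lemma blkc_step x i : blkc U i (step x i) = blkc U i x + T x i.
Proof. by rewrite /ucdc_step blkcD blkc_Ublk. Qed.

Lemma blkc_step_neq x i j : j != i -> blkc U j (step x i) = blkc U j x.
Proof. by move=> ji; rewrite /ucdc_step blkcD blkc_Ublk_neq// addr0. Qed.

(** A competitor [t] of finite value forces the minimal value to be finite, so the optimality of
    [T x i] can be read in the reals. *)
Lemma step_psi_le x i (t : 'cV[R]_(Ns i)) :
  Psis i (blkc U i x + t) \is a fin_num ->
  Psis i (blkc U i (step x i)) \is a fin_num /\
  ((gradi U f i x)^T *m T x i) 0 0 + L i / 2 * bnorm (B i) (T x i) ^+ 2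
    + psi i (step x i) <=
  ((gradi U f i x)^T *m t) 0 0 + L i / 2 * bnorm (B i) t ^+ 2
    + fine (Psis i (blkc U i x + t)).
Proof.
move=> Pt; have := Targmin x i t; rewrite /step_obj /psi blkc_step.
move: Pt; case: (Psis i (blkc U i x + t)) => // p _.
have := @Psis_fin i (blkc U i x + T x i).
by case: (Psis i (blkc U i x + T x i)) => [q _|_|/(_ isT)].
Qed.

Lemma step_fin x i : F x \is a fin_num -> F (step x i) \is a fin_num.
Proof.
move=> Fx; rewrite Fobj_finE; apply/forallP => j.
have [->|ji] := eqVneq j i; last by rewrite blkc_step_neq// Psis_blkc_fin.
have := @step_psi_le x i 0; rewrite addr0.
by case=> //; apply: Psis_blkc_fin.
Qed.

(** Only block [i] moves, so the separable part changes by a single term; block descent at [T x i]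
    followed by optimality against [t] gives the bound. *)
Lemma step_decrease x i (t : 'cV[R]_(Ns i)) : F x \is a fin_num ->
  Psis i (blkc U i x + t) \is a fin_num ->
  fine (F (step x i)) <= fine (F x) + (((gradi U f i x)^T *m t) 0 0
    + L i / 2 * bnorm (B i) t ^+ 2 + fine (Psis i (blkc U i x + t)) - psi i x).
Proof.
move=> Fx Pt; have [_] := step_psi_le x i t Pt.
have := block_descent U f fdiff B L Bpos fLip x i (T x i).
rewrite (fine_Fobj _ (step_fin _ i Fx)) (fine_Fobj _ Fx).
have -> : \sum_(j < n) psi j (step x i) =
    \sum_(j < n) psi j x + (psi i (step x i) - psi i x).
  rewrite [LHS](bigD1 i)//= [X in _ = X + _](bigD1 i)//=.
  rewrite (eq_bigr (psi^~ x)) => [|j ji]; last by rewrite /psi blkc_step_neq.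
  by rewrite addrAC addrCA subrr addr0.
rewrite -/(step x i); move: (f (step x i)) (f x) => f1 f0.
move: (psi i (step x i)) (psi i x) => p1 p0.
move: (_ 0 0) (_ 0 0) (bnorm _ _) (bnorm _ _) (\sum_(_ < _) _ : R) => g1 g2 b1 b2 s.
by move: (fine _) => q; lra.
Qed.

Lemma step_le x i : F x \is a fin_num -> fine (F (step x i)) <= fine (F x).
Proof.
move=> Fx; have := @step_decrease x i 0 Fx; rewrite addr0 => H.
have := H (Psis_blkc_fin _ i Fx); rewrite mulmx0 mxE -/(psi i x) /bnorm qform0.
by rewrite sqrtr0 expr0n mulr0 !add0r subrr addr0.
Qed.

Lemma block_Lnorm_sqr x :
  Defs.Lnorm U B L x ^+ 2 = \sum_(i < n) L i * bnorm (B i) (blkc U i x) ^+ 2.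
Proof.
rewrite /Defs.Lnorm sqr_sqrtr//; apply: sumr_ge0 => i _.
by rewrite mulr_ge0 ?sqr_ge0 ?ltW.
Qed.

(* Comparing the step in every block with the block of [a (z - x)] and summing. *)
Lemma sum_step_decrease x z (a : R) : F x \is a fin_num -> F z \is a fin_num ->
  0 <= a <= 1 ->
  \sum_(i < n) fine (F (step x i)) <=
  n%:R * fine (F x) - a * (fine (F x) - fine (F z))
    + a ^+ 2 / 2 * Defs.Lnorm U B L (x - z) ^+ 2.
Proof.
move=> Fx Fz a01.
(* The point is a convex combination of the blocks of [z] and [x], so convexity gives both
   finiteness and the bound. *)
have Pconv i : Psis i (blkc U i x + a *: blkc U i (z - x)) \is a fin_num /\
  fine (Psis i (blkc U i x + a *: blkc U i (z - x))) <=
    a * psi i z + (1 - a) * psi i x.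
  have -> : blkc U i x + a *: blkc U i (z - x) =
      a *: blkc U i z + (1 - a) *: blkc U i x.
    by rewrite blkcD blkcN scalerBr scalerBl scale1r addrCA addrA.
  case: (Psis_pcc i) => _ _ /(_ (blkc U i z) (blkc U i x) a a01).
  rewrite /psi; move: (Psis_blkc_fin _ i Fx) (Psis_blkc_fin _ i Fz).
  case: (Psis i (blkc U i x)) => // p _; case: (Psis i (blkc U i z)) => // q _ /=.
  rewrite -!EFinM -EFinD; move: (_ + _ : 'cV_(Ns i)) => w Pw.
  have Pfin : Psis i w \is a fin_num.
    by apply: Psis_fin; apply: le_lt_trans Pw _; rewrite ltry.
  by split => //; move: Pw; rewrite -{1}(fineK Pfin) lee_fin.
have blk i : fine (F (step x i)) <= fine (F x) +
    (a * ((gradi U f i x)^T *m blkc U i (z - x)) 0 0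
     + a ^+ 2 / 2 * (L i * bnorm (B i) (blkc U i (x - z)) ^+ 2)
     + a * (psi i z - psi i x)).
  case: (Pconv i) => Pf Pc.
  have := @step_decrease x i _ Fx Pf.
  have -> : ((gradi U f i x)^T *m (a *: blkc U i (z - x))) 0 0 =
      a * ((gradi U f i x)^T *m blkc U i (z - x)) 0 0.
    by rewrite -scalemxAr mxE.
  have -> : bnorm (B i) (a *: blkc U i (z - x)) ^+ 2 =
      a ^+ 2 * bnorm (B i) (blkc U i (x - z)) ^+ 2.
    rewrite !bnorm_sqr// -opprB blkcN -scaleN1r scalerA qformZ; ring.
  move: Pc; move: (fine (F _)) (fine (F _)) (fine _) (_ 0 0) (bnorm _ _).
  by move: (psi i x) (psi i z) => p q; move=> ? ? ? ? ?; lra.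
apply: le_trans (ler_sum _ (fun i _ => blk i)) _.
rewrite big_split /= sumr_const card_ord -[in leLHS]mulr_natl.
rewrite !big_split /= -!mulr_sumr -block_Lnorm_sqr sumrB.
have -> : \sum_(i < n) ((gradi U f i x)^T *m blkc U i (z - x)) 0 0 =
    ((grad f x)^T *m (z - x)) 0 0 by exact: sum_blkc_dot.
(* The linear terms reassemble into the full gradient pairing; convexity of [f], scaled by [a],
   bounds it by [a * (f z - f x)]. *)
have := convex_gradient_ineq f fdiff x z fconv.
rewrite (fine_Fobj _ Fz) (fine_Fobj _ Fx).
move: (_ 0 0) (Defs.Lnorm _ _ _ _).
move: (\sum_(i < n) psi i x) (\sum_(i < n) psi i z) => s1 s2 g l.
move: (f x) (f z) => f1 f2 gf.
have : a * (f1 + g) <= a * f2 by rewrite ler_wpM2l//; case/andP: a01.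
by lra.
Qed.

End Objective.

(** * From the one-step bound to the probability estimate *)

Theorem theorem4 (R : realType) (n : nat) (Ns : 'I_n -> nat)
  (U : 'M[R]_(\sum_(i < n) Ns i))
  (B : forall i : 'I_n, 'M[R]_(Ns i))
  (f : 'cV[R]_(\sum_(i < n) Ns i) -> R)
  (L : 'I_n -> R)
  (Psis : forall i : 'I_n, 'cV[R]_(Ns i) -> \bar R)
  (T : 'cV[R]_(\sum_(i < n) Ns i) -> forall i : 'I_n, 'cV[R]_(Ns i))
  (x0 : 'cV[R]_(\sum_(i < n) Ns i)) (rho eps : R) (k : nat) :
  (0 < n)%N ->
  is_perm_mx U ->
  (forall i, posdef (B i)) ->
  (forall x, differentiable f x) ->
  convex_fun f ->
  (forall i, 0 < L i) ->
  (forall x i (t : 'cV[R]_(Ns i)),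
      bdual (B i) (gradi U f i (x + Ublk U i *m t) - gradi U f i x)
        <= L i * bnorm (B i) t) ->
  (forall i, proper_closed_convex (Psis i)) ->
  (exists xs, minimizers (Fobj U f Psis) xs) ->
  (* F(x0) and R_L(x0) are finite *)
  (Fobj U f Psis x0 < +oo)%E ->
  has_ubound (RLset U B L (Fobj U f Psis) x0) ->
  is_step_argmin U B L f Psis T ->
  0 < rho < 1 -> 0 < eps ->
  let gap := fine (Fobj U f Psis x0 - optval (Fobj U f Psis))%E in
  let RL2 := RL U B L (Fobj U f Psis) x0 ^+ 2 in
  let M := Num.max RL2 gap in
  (eps < gap /\
     2 * n%:R * M / eps * (1 + ln rho^-1) + 2 - 2 * n%:R * M / gap <= k%:R)
  \/
  (eps < Num.min RL2 gap /\
     2 * n%:R * RL2 / eps * ln (gap / (eps * rho)) <= k%:R) ->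
  1 - rho <= @unif_prob R n k
    (fun s : k.-tuple 'I_n =>
       (Fobj U f Psis (ucdc U T x0 s) - optval (Fobj U f Psis) <= eps%:E)%E).
Proof.
move=> n0 Uperm Bpos fdiff fconv Lpos fLip Ppcc [xs xsmin] Fx0 RLub Targ.
move=> rho01 eps0 gap RL2 M kbound.
have := sum_step_decrease U B f L Psis T Uperm Bpos fdiff fconv fLip Lpos Ppcc Targ.
have := step_le U B f L Psis T Uperm Bpos fdiff fLip Ppcc Targ.
have := step_fin U B f L Psis T Uperm Ppcc Targ.
have Ffin := Fobj_fin U f Psis Ppcc.
rewrite -[ucdc U T x0]/(foldl (ucdc_step U T) x0).
set step := ucdc_step U T.
(* The supremum is over a nonempty set bounded above, so it dominates the distance to [xs]; squaring
   also requires it to be nonnegative. *)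
have RLbound x : (Fobj U f Psis x <= Fobj U f Psis x0)%E ->
    Defs.Lnorm U B L (x - xs) ^+ 2 <= RL2.
  move=> Fx; rewrite /RL2 lerXn2r ?nnegrE ?sqrtr_ge0//.
    apply: le_trans (sqrtr_ge0 _) (_ : Defs.Lnorm U B L (x - xs) <= _).
    apply: sup_upper_bound; last by exists x, xs.
    by split => //; exists (Defs.Lnorm U B L (x - xs)), x, xs.
  apply: sup_upper_bound; last by exists x, xs.
  by split => //; exists (Defs.Lnorm U B L (x - xs)), x, xs.
have ME : M = Num.max RL2 gap by [].
have gapE : gap = fine (Fobj U f Psis x0 - optval (Fobj U f Psis))%E by [].
clearbody M gap RL2; move: gapE Fx0 RLbound Ffin xsmin.
rewrite /minimizers /mkset /optval; move: (Fobj U f Psis) => F.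
move=> gapE Fx0 RLbound Ffin xsmin.
move=> Ffstep Fstep Fsum.
have Fxs : F xs \is a fin_num by apply/Ffin/(le_lt_trans (xsmin x0)).
have optE : ereal_inf (range F) = F xs.
  apply/eqP; rewrite eq_le; apply/andP; split.
    by apply: ereal_inf_lbound; exists xs.
  by apply: le_ereal_inf_tmp => _ [y _ <-].
pose xi x := fine (F x) - fine (F xs).
have xi0E : gap = xi x0 by rewrite gapE optE /xi fineB// Ffin.
(* The initial sublevel set is invariant because steps decrease [F]; on it [F] is finite and
   [RLbound] applies. *)
pose S x := (F x <= F x0)%E.
have SF x : S x -> F x \is a fin_num by move=> Sx; apply/Ffin/(le_lt_trans Sx).
have Sstep x i : S x -> S (step x i).
  move=> Sx; apply: le_trans (Sx).
  by rewrite -(fineK (SF _ Sx)) -(fineK (Ffstep _ i (SF _ Sx))) lee_fin Fstep ?SF.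
have xi_ge0 x : S x -> 0 <= xi x by move=> Sx; rewrite subr_ge0 (fine_le Fxs (SF _ Sx)).
have xi_le x : S x -> xi x <= gap.
  by move=> Sx; rewrite xi0E lerD2r (fine_le (SF _ Sx))// Ffin.
have xi_step x i : S x -> xi (step x i) <= xi x.
  by move=> Sx; rewrite lerD2r Fstep ?SF.
have nR : 0 < n%:R :> R by rewrite ltr0n.
have avg_xi x (a : R) : S x -> 0 <= a <= 1 ->
    avg step xi x <= xi x - (a * xi x - a ^+ 2 / 2 * RL2) / n%:R.
  move=> Sx a01; rewrite /avg ler_pdivrMr// sumrB sumr_const card_ord.
  have := Fsum x xs a (SF _ Sx) Fxs a01; rewrite -/(xi x) => D.
  have : a ^+ 2 / 2 * Defs.Lnorm U B L (x - xs) ^+ 2 <= a ^+ 2 / 2 * RL2.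
    by rewrite ler_wpM2l ?RLbound ?divr_ge0 ?sqr_ge0.
  rewrite mulrBl mulfVK ?gt_eqF// -mulr_natr.
  by move: D; rewrite /xi; move: (Defs.Lnorm _ _ _ _) => l; lra.
have Sx0 : S x0 by rewrite /S.
apply: (@le_trans _ _ (iter k (avg step) (fun y => `[< xi y <= eps >]%:R) x0)).
  case: kbound => [[eg hk]|[+ hk]].
    have g0 : 0 < gap by apply: lt_trans eg.
    have gM : gap <= M by rewrite ME le_max lexx orbT.
    have RM : RL2 <= M by rewrite ME le_max lexx.
    have M0 : 0 < M by apply: lt_le_trans gM.
    have n1 : 1 <= n%:R :> R by rewrite ler1n.
    apply: (chain_prob_sublinear step n0 S Sstep xi eps eps0 xi_ge0 xi_step
      (2 * n%:R * M)) => //; rewrite -?xi0E ?(ltW eg)//.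
      by apply: le_trans (ltW (lt_le_trans eg gM)) _; nra.
    move=> y Sy; have xiy := xi_ge0 _ Sy.
    (* Admissible since [xi y <= gap <= M]; bounding [RL2] by [M] then leaves a decrease of
       [xi y ^+ 2 / (2 * n%:R * M)]. *)
    have a01 : 0 <= xi y / M <= 1.
      by rewrite divr_ge0 ?(ltW M0)//= ler_pdivrMr// mul1r (le_trans (xi_le _ Sy)).
    apply: le_trans (avg_xi y _ Sy a01) _.
    rewrite lerD2l lerN2.
    have -> : xi y ^+ 2 / (2 * n%:R * M) =
        (xi y / M * xi y - (xi y / M) ^+ 2 / 2 * M) / n%:R.
      by field; rewrite !gt_eqF.
    rewrite ler_pM2r ?invr_gt0// lerD2l lerN2 ler_wpM2l//.
    by rewrite divr_ge0 ?sqr_ge0.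
  rewrite lt_min => /andP[eR eg].
  have R0 : 0 < RL2 by apply: lt_trans eR.
  have n1 : 1 <= n%:R :> R by rewrite ler1n.
  have [r0 _] := andP rho01.
  apply: (chain_prob_geometric step n0 S Sstep xi eps eps0 xi_ge0 xi_step
    (2 * n%:R * RL2 / eps)) => //; rewrite -?xi0E//.
    by rewrite ler_pdivlMr// mul1r; nra.
  move=> y Sy ey; have xiy := xi_ge0 _ Sy.
  have a01 : 0 <= eps / RL2 <= 1.
    by rewrite divr_ge0 ?(ltW R0) ?(ltW eps0)//= ler_pdivrMr// mul1r ltW.
  apply: le_trans (avg_xi y _ Sy a01) _.
  rewrite [leRHS]mulrBl mul1r lerD2l lerN2.
  have -> : (2 * n%:R * RL2 / eps)^-1 * xi y = (eps / RL2 * (xi y / 2)) / n%:R.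
    by field; rewrite !gt_eqF.
  rewrite ler_pM2r ?invr_gt0//.
  (* As [eps <= xi y], the quadratic loss costs at most half of the linear gain
     [eps / RL2 * xi y]. *)
  have -> : (eps / RL2) ^+ 2 / 2 * RL2 = eps / RL2 * (eps / 2).
    by field; rewrite !gt_eqF.
  have [a0 _] := andP a01.
  by rewrite -mulrBr ler_wpM2l//; lra.
rewrite (unif_prob_foldl step k (fun y => F y - ereal_inf (range F) <= eps%:E)%E).
apply: (iter_avg_le step S Sstep) => // y Sy.
rewrite optE -(fineK (SF _ Sy)) -(fineK Fxs) -EFinB lee_fin -/(xi y).
by [].
Qed.
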